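(* Let $X$ be a real Banach space with $\dim X\ge 2$. The following are equivalent: (1) $X$ is uniformly nonsquare; (2) $J_\lambda^\perp(X)<1$ for every $\lambda\in(0,1)$; (3) $J_\lambda^\perp(X)<1$ for some $\lambda\in(0,1)$.
   Context: For a real Banach space $X$, $S_X=\{x\in X:\|x\|=1\}$. For $x,y\in X$, $x\perp_B y$ (Birkhoff--James orthogonality) means $\|x\|\le\|x+ty\|$ for every $t\in\mathbb R$. For $\lambda\in[0,1]$, $$J_\lambda^\perp(X)=\sup\{\min\{\|\lambda x+(1-\lambda)y\|,\|\lambda x-(1-\lambda)y\|\}: x,y\in S_X,\ x\perp_B y\}.$$ $X$ is uniformly nonsquare if there exists $\varepsilon>0$ such that $\min\{\|x+y\|,\|x-y\|\}\le 2-\varepsilon$ for all $x,y\in S_X$. *)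

(* Defs.v *)
From HB Require Import structures.
From mathcomp Require Import all_boot all_order all_algebra.
From mathcomp Require Import all_classical all_reals all_analysis.
Import Order.TTheory GRing.Theory Num.Theory.
Import numFieldNormedType.Exports.

Set Implicit Arguments.
Unset Strict Implicit.
Unset Printing Implicit Defensive.

Local Open Scope classical_set_scope.
Local Open Scope ring_scope.

Definition unit_sphere (R : realType) (X : normedModType R) : set X :=
  [set x | `|x| = 1].

Definition birkhoff_james (R : realType) (X : normedModType R) (x y : X) : Prop :=
  forall t : R, `|x| <= `|x + t *: y|.

(* The vector-space dimension is at least 2, possibly infinite. *)
Definition dim_ge2 (R : realType) (X : normedModType R) : Prop :=
  exists x y : X, forall a b : R, a *: x + b *: y = 0 -> a = 0 /\ b = 0.

(* [sup] is 0 on the empty set; when the dimension of X is at least 2 and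
   0 <= lambda <= 1, the set below is nonempty and bounded above by 1. *)
Definition J_perp (R : realType) (X : normedModType R) (lambda : R) : R :=
  sup [set r : R | exists x y : X,
    [/\ unit_sphere x, unit_sphere y, birkhoff_james x y &
        r = Num.min `|lambda *: x + (1 - lambda) *: y|
                    `|lambda *: x - (1 - lambda) *: y|]].

Definition uniformly_nonsquare (R : realType) (X : normedModType R) : Prop :=
  exists2 e : R, 0 < e &
    forall x y : X, unit_sphere x -> unit_sphere y ->
      Num.min `|x + y| `|x - y| <= 2 - e.

Arguments dim_ge2 {R} X.
Arguments J_perp {R} X lambda.
Arguments uniformly_nonsquare {R} X.

(* Main.v *)
Require Import Defs.
From HB Require Import structures.
From mathcomp Require Import all_boot all_order all_algebra.
From mathcomp Require Import all_classical all_reals all_analysis.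
From mathcomp Require Import lra.
Import Order.TTheory GRing.Theory Num.Theory.
Import numFieldNormedType.Exports.
Local Open Scope ring_scope.

(** Uniform nonsquareness fails exactly when there are unit vectors x, y with
    both [|x + y|] and [|x - y|] arbitrarily close to 2, that is, when the norm
    on the span of x and y is arbitrarily close to the l1 norm in the
    coordinates along x and y.

    If X is uniformly nonsquare, every convex combination
    [lambda x +- (1 - lambda) y] contains the multiple
    [min(lambda, 1 - lambda) (x +- y)], whose defect from the triangle
    inequality survives in the whole sum ([norm_conic_le]).  This bounds
    [J_perp X lambda] away from 1 for every lambda in ]0, 1[
    ([uniformly_nonsquare_J_perp_lt1]).

    Conversely, let x, y be unit vectors with [|x + y|], [|x - y| >= 2 - e].
    Then [|a x + b y| >= |a| + |b| - e max(|a|, |b|)] for all a, b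
    ([norm_almost_l1]).  A minimizer t0 of [t |-> |x + t y|] gives a vector
    [x + t0 y] orthogonal to y.  The lower bound and the value 1 at [t = 0]
    force [|t0| <= e max(1, |t0|)], hence t0 is small, and normalizing
    [x + t0 y] gives a vector within O(e) of x ([birkhoff_james_near]).  The resulting
    orthogonal pair shows that [J_perp X lambda >= 1 - O(e)] for every lambda,
    so a single lambda with [J_perp X lambda < 1] bounds e from below
    ([J_perp_lt1_uniformly_nonsquare]). *)

(** * Norms of combinations of two unit vectors *)

Section TwoUnitVectors.
Set Implicit Arguments.
Unset Strict Implicit.
Variables (R : realType) (X : normedModType R).
Implicit Types (x y : X) (a b e t : R).

(** Splitting off [m (x + y)] with m below both coefficients leaves a conic
    combination to which the triangle inequality applies without loss. *)
Lemma norm_conic_le x y a b m : `|x| = 1 -> `|y| = 1 ->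
  0 <= m -> m <= a -> m <= b ->
  `|a *: x + b *: y| <= a + b - m * (2 - `|x + y|).
Proof.
move=> x1 y1 m0 ma mb.
have -> : a *: x + b *: y = m *: (x + y) + ((a - m) *: x + (b - m) *: y).
  by rewrite scalerDr addrACA -!scalerDl !subrKC.
apply: le_trans (ler_normD _ _) _; rewrite normrZ (ger0_norm m0).
have := ler_normD ((a - m) *: x) ((b - m) *: y).
rewrite !normrZ x1 y1 !ger0_norm ?subr_ge0 //; lra.
Qed.

(** An almost square pair spans an almost l1 plane: with [|b| <= |a|] and equal
    signs, [a x + b y] is [a (x + y)], of norm almost [2 |a|], minus a multiple
    of y of norm [|a| - |b|]; other signs reduce to this by symmetry. *)
Lemma norm_almost_l1_dominant x y a b e : `|x| = 1 -> `|y| = 1 ->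
  2 - e <= `|x + y| -> 2 - e <= `|x - y| -> `|b| <= `|a| ->
  `|a| + `|b| - e * `|a| <= `|a *: x + b *: y|.
Proof.
wlog a0 : a b / 0 <= a => [hw|] x1 y1 hp hm.
  case: (leP 0 a) => [|a0]; first by move=> a0; apply: hw.
  rewrite -(normrN a) -(normrN b) -(normrN (a *: x + _)) opprD -(scaleNr a) -(scaleNr b).
  by apply: hw => //; rewrite oppr_ge0 ltW.
wlog b0 : b y y1 hp hm / 0 <= b => [hw|].
  case: (leP 0 b) => [|b0]; first by move=> b0; apply: hw.
  rewrite -(normrN b) -(opprK (b *: y)) -(scaleNr b) -(scalerN _ y).
  by apply: hw; rewrite ?normrN ?opprK // oppr_ge0 ltW.
rewrite (ger0_norm a0) (ger0_norm b0) => ba.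
have -> : a *: x + b *: y = a *: (x + y) - (a - b) *: y.
  by rewrite scalerDr scalerBl opprB -addrA subrKC.
have := lerB_dist (a *: (x + y)) ((a - b) *: y).
rewrite !normrZ y1 (ger0_norm a0) ger0_norm ?subr_ge0 //.
have := ler_wpM2l a0 hp; lra.
Qed.

Lemma norm_almost_l1 x y a b e : `|x| = 1 -> `|y| = 1 ->
  2 - e <= `|x + y| -> 2 - e <= `|x - y| ->
  `|a| + `|b| - e * Num.max `|a| `|b| <= `|a *: x + b *: y|.
Proof.
move=> x1 y1 hp hm; case: (leP `|a| `|b|) => [ab|/ltW ba].
  rewrite [a *: x + _]addrC (addrC `|a|).
  by apply: norm_almost_l1_dominant; rewrite // 1?distrC // (addrC y).
exact: norm_almost_l1_dominant.
Qed.

(** * Birkhoff--James orthogonality by minimization *)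

(** The distance from x to the line through y is attained: the minimum over
    [-2, 2] is global, since [|x + t y| >= |t| - 1 >= |x|] outside. *)
Lemma exists_birkhoff_james_shift x y : `|x| = 1 -> `|y| = 1 ->
  exists t : R, birkhoff_james (x + t *: y) y.
Proof.
move=> x1 y1; pose f (t : R) : R := `|x + t *: y|.
have f_cont : ({within `[(-2)%R, 2%R], continuous f})%classic.
  apply: continuous_subspaceT => t.
  apply: (@continuous_comp _ _ _ (fun s : R => x + s *: y)).
    by apply: cvgD; [exact: cvg_cst | apply: cvgZr_tmp; exact: cvg_id].
  exact: norm_continuous.
have [|t tI fmin] := EVT_min _ f_cont; first by lra.
exists t => s; rewrite -addrA -scalerDl -/(f t) -/(f (t + s)).
case: (boolP (t + s \in `[-2, 2])) => [/fmin //|out].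
have t0 : f t <= 1.
  rewrite -x1 -[x in leRHS]addr0 -(scale0r y); apply: (fmin 0).
  by rewrite in_itv /=; lra.
apply: le_trans t0 _.
have : 2 <= `|t + s|.
  by rewrite leNgt; apply: contra out => /ltW; rewrite in_itv /= ler_norml.
have := ler_normB (x + (t + s) *: y) x.
rewrite addrC addKr normrZ x1 y1 -/(f (t + s)); lra.
Qed.

Lemma birkhoff_jamesZ x y c : birkhoff_james x y -> birkhoff_james (c *: x) y.
Proof.
move=> xy t; have [->|c0] := eqVneq c 0; first by rewrite scale0r normr0.
have -> : c *: x + t *: y = c *: (x + (c^-1 * t) *: y).
  by rewrite scalerDr scalerA mulVKf.
by rewrite !normrZ ler_wpM2l.
Qed.

(** In an almost l1 plane the foot of the minimization is close to x, because
    the l1 norm of [x + t y] grows like [1 + |t|]. *)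
Lemma birkhoff_james_near x y e : `|x| = 1 -> `|y| = 1 -> e <= 4^-1 ->
  2 - e <= `|x + y| -> 2 - e <= `|x - y| ->
  exists z : X, [/\ `|z| = 1, birkhoff_james z y & `|z - x| <= 2 * e].
Proof.
move=> x1 y1 e4 hp hm.
have e0 : 0 <= e by have := ler_normD x y; lra.
have [t ty] := exists_birkhoff_james_shift x1 y1.
set w := x + t *: y in ty *.
have w1 : `|w| <= 1 by have := ty (- t); rewrite scaleNr addrK x1.
have te : `|t| <= e.
  have := norm_almost_l1 1 t x1 y1 hp hm.
  rewrite scale1r normr1 -/w; case: (leP 1 `|t|) => ht; last by lra.
  by have := ler_wpM2r (normr_ge0 t) e4; lra.
have wx : `|w - x| = `|t| by rewrite /w addrC addKr normrZ y1 mulr1.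
have w1t : 1 - `|t| <= `|w|.
  by rewrite -wx; have := ler_normB w (w - x); rewrite opprB subrKC x1; lra.
have w0 : 0 < `|w| by lra.
exists (`|w|^-1 *: w); split.
- by rewrite normrZ normfV normr_id mulVf ?gt_eqF.
- exact: birkhoff_jamesZ.
have -> : `|w|^-1 *: w - x = (`|w|^-1 - 1) *: w + (w - x).
  by rewrite scalerBl scale1r subrKA.
apply: le_trans (ler_normD _ _) _; rewrite wx normrZ.
(* Normalizing moves w by exactly [1 - |w|], itself at most [|t|]. *)
have -> : `| `|w|^-1 - 1| * `|w| = 1 - `|w|.
  by rewrite -{2}(normr_id w) -normrM mulrBl mulVf ?gt_eqF // mul1r ger0_norm;
    lra.
lra.
Qed.

End TwoUnitVectors.

(** * The orthogonal constant and uniform nonsquareness *)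

Section OrthogonalConstant.
Set Implicit Arguments.
Unset Strict Implicit.
Variables (R : realType) (X : normedModType R).

(** The set defining [J_perp] has the upper bound 1, so its supremum dominates
    its elements. *)
Lemma J_perp_ge (lambda : R) (x y : X) : 0 <= lambda <= 1 ->
  `|x| = 1 -> `|y| = 1 -> birkhoff_james x y ->
  Num.min `|lambda *: x + (1 - lambda) *: y|
          `|lambda *: x - (1 - lambda) *: y| <= J_perp X lambda.
Proof.
move=> /andP[l0 l1] x1 y1 xy; apply: ub_le_sup; last by exists x, y.
exists 1 => _ [u [v [u1 v1 _ ->]]]; rewrite ge_min; apply/orP; left.
apply: le_trans (ler_normD _ _) _.
by rewrite !normrZ u1 v1 !ger0_norm ?subr_ge0 //; lra.
Qed.

Lemma uniformly_nonsquare_J_perp_lt1 (lambda : R) :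
  uniformly_nonsquare X -> 0 < lambda < 1 -> J_perp X lambda < 1.
Proof.
move=> [e e0 nsq] /andP[l0 l1]; rewrite /J_perp.
set A := [set _ | _]%classic.
have [->|/set0P A0] := eqVneq A set0; first by rewrite sup0.
pose m := Num.min lambda (1 - lambda).
have m0 : 0 < m by rewrite lt_min l0 subr_gt0.
have ml : m <= lambda by rewrite ge_min lexx.
have mr : m <= 1 - lambda by rewrite ge_min lexx orbT.
apply: (@le_lt_trans _ _ (1 - m * e)); last by have := mulr_gt0 m0 e0; lra.
apply: ge_sup => // _ [x [y [x1 y1 _ ->]]].
have [||] := orP (_ : (`|x + y| <= 2 - e) || (`|x - y| <= 2 - e)).
- by rewrite -ge_min; exact: nsq.
- move=> h; rewrite ge_min; apply/orP; left.
  have := norm_conic_le x1 y1 (ltW m0) ml mr.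
  have : m * e <= m * (2 - `|x + y|) by rewrite ler_pM2l //; lra.
  lra.
- move=> h; rewrite ge_min; apply/orP; right.
  have yN1 : `|- y| = 1 by rewrite normrN.
  have := norm_conic_le x1 yN1 (ltW m0) ml mr; rewrite scalerN.
  have : m * e <= m * (2 - `|x - y|) by rewrite ler_pM2l //; lra.
  lra.
Qed.

Lemma J_perp_lt1_uniformly_nonsquare (lambda : R) :
  0 < lambda < 1 -> J_perp X lambda < 1 -> uniformly_nonsquare X.
Proof.
move=> /andP[l0 l1] J1.
(* Replacing x by z costs at most [2 e], and the almost l1 bound costs at most
   e, so that [3 e < 1 - J_perp X lambda] is what the contradiction needs. *)
pose e := Num.min 4^-1 ((1 - J_perp X lambda) / 4).
have e4 : e <= 4^-1 by rewrite ge_min lexx.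
have eJ : e <= (1 - J_perp X lambda) / 4 by rewrite ge_min lexx orbT.
have e0 : 0 < e by rewrite lt_min; apply/andP; split; lra.
exists e => // x y x1 y1; rewrite leNgt; apply/negP.
rewrite lt_min => /andP[/ltW hp /ltW hm].
have [z [z1 zy zx]] := birkhoff_james_near x1 y1 e4 hp hm.
have lower b : `|b| = 1 - lambda -> 1 - 3 * e <= `|lambda *: z + b *: y|.
  move=> b1; have := norm_almost_l1 lambda b x1 y1 hp hm.
  rewrite b1 (gtr0_norm l0).
  have : e * Num.max lambda (1 - lambda) <= e.
    by rewrite ler_piMr ?(ltW e0) // ge_max; apply/andP; split; lra.
  have -> : lambda *: x + b *: y =
      (lambda *: z + b *: y) - lambda *: (z - x).
    by rewrite scalerBr opprB [RHS]addrC addrA subrK.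
  have := ler_normB (lambda *: z + b *: y) (lambda *: (z - x)).
  rewrite normrZ (gtr0_norm l0).
  have : lambda * `|z - x| <= `|z - x| by rewrite ler_piMl // ltW.
  lra.
have l01 : 0 <= lambda <= 1 by rewrite !ltW.
have := J_perp_ge l01 z1 y1 zy; apply/negP; rewrite -ltNge.
apply: (@lt_le_trans _ _ (1 - 3 * e)); first by lra.
rewrite le_min -(scaleNr _ y) !lower // ?normrN ger0_norm //; lra.
Qed.

End OrthogonalConstant.

Theorem corollary3p7 (R : realType) (X : completeNormedModType R)
    (hdim : dim_ge2 X) :
  (uniformly_nonsquare X <->
     (forall lambda : R, 0 < lambda < 1 -> J_perp X lambda < 1)) /\
  ((forall lambda : R, 0 < lambda < 1 -> J_perp X lambda < 1) <->
     (exists lambda : R, 0 < lambda < 1 /\ J_perp X lambda < 1)).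
Proof.
have half01 : 0 < (2^-1 : R) < 1 by apply/andP; split; lra.
split; split.
- by move=> nsq lambda; exact: uniformly_nonsquare_J_perp_lt1.
- by move=> /(_ _ half01); exact: J_perp_lt1_uniformly_nonsquare.
- by move=> J1; exists 2^-1; split; [|exact: J1].
- move=> [mu [mu01 Jmu]] lambda; apply: uniformly_nonsquare_J_perp_lt1.
  exact: J_perp_lt1_uniformly_nonsquare mu01 Jmu.
Qed.
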